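(* Let $\alpha,\beta,\tilde\alpha,\tilde\beta,b,p,q>0$ with $p\le\tilde\alpha$. Define, for $s>0$, $$f^{DSD}(s)=\mathcal{K}_{DSD}\;s^{-q-1}\,{}_2F_1\!\left(q+\alpha,\;q+p;\;q+\tilde\alpha;\;-\frac{b\tilde\beta}{s\beta}\right),\qquad \mathcal{K}_{DSD}=\left(\frac{b\tilde\beta}{\beta}\right)^{q}\frac{1}{B(p,q)}\,\frac{\Gamma(\tilde\alpha)}{\Gamma(q+\tilde\alpha)}\,\frac{\Gamma(q+\alpha)}{\Gamma(\alpha)}.$$ Then $f^{DSD}$ is a probability density on $(0,\infty)$ (it is strictly positive and integrates to $1$), and it solves the integral equation $$\int_0^{\infty} g_{\tilde\alpha,\tilde\beta/s}(v)\,f^{DSD}(s)\,\mathrm{d}s=f_{\mathcal V}(v)\qquad\text{for all } v>0,$$ where $g_{a,r}$ is the density of $\mathrm{Gamma}(a,r)$ and $f_{\mathcal V}$ is the density of the ${}_2\mathcal{F}_0(\alpha,\beta/b,p,q)$ distribution.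
   Context: $\mathrm{Gamma}(a,r)$ denotes the gamma distribution with shape $a>0$ and rate $r>0$, with density $g_{a,r}(x)=\frac{r^a}{\Gamma(a)}x^{a-1}e^{-rx}$ on $(0,\infty)$. $\mathrm{B2}(b,p,q)$ is the distribution on $(0,\infty)$ with density $\frac{b^q}{B(p,q)}\,s^{-q-1}\left(1+\frac{b}{s}\right)^{-p-q}$, $B(\cdot,\cdot)$ being the Beta function. The ${}_2\mathcal{F}_0(\alpha,\beta/b,p,q)$ distribution is the marginal law of $X$ when $X\mid Y=y\sim\mathrm{Gamma}(\alpha,\beta/y)$ and $Y\sim\mathrm{B2}(b,p,q)$, i.e. $f_{\mathcal V}(v)=\int_0^\infty g_{\alpha,\beta/y}(v)\,\frac{b^q}{B(p,q)}y^{-q-1}(1+b/y)^{-p-q}\,\mathrm{d}y$. ${}_2F_1(a,c;d;x)$ is the Gauss hypergeometric function (for $x<0$ its analytic continuation/principal branch). *)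

(* Defs.v *)
From HB Require Import structures.
From mathcomp Require Import all_boot all_order all_algebra.
From mathcomp Require Import all_classical all_reals all_analysis.
Set Implicit Arguments. Unset Strict Implicit. Unset Printing Implicit Defensive.
Import Order.TTheory GRing.Theory Num.Theory.
Import numFieldNormedType.Exports.
Local Open Scope classical_set_scope.
Local Open Scope ring_scope.

Section defs.
Variable R : realType.

Definition posR : set R := `]0, +oo[%classic.

Definition Gammaf (a : R) : R :=
  Rintegral (@lebesgue_measure R) posR
    (fun x => x `^ (a - 1) * expR (- x)).

Definition Betaf (p q : R) : R :=
  Rintegral (@lebesgue_measure R) `]0, 1[%classic
    (fun t => t `^ (p - 1) * (1 - t) `^ (q - 1)).

Definition gamma_pdf (a r x : R) : R :=
  r `^ a / Gammaf a * x `^ (a - 1) * expR (- (r * x)).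

Definition B2_pdf (b p q s : R) : R :=
  b `^ q / Betaf p q * s `^ (- q - 1) * (1 + b / s) `^ (- p - q).

Definition F20_pdf (alpha beta b p q v : R) : \bar R :=
  (\int[@lebesgue_measure R]_(y in posR)
     (gamma_pdf alpha (beta / y) v * B2_pdf b p q y)%:E)%E.

Definition poch (x : R) (n : nat) : R := \prod_(i < n) (x + i%:R).

Definition hyp2F1_series (a c d z : R) : R :=
  limn (fun N : nat => \sum_(0 <= n < N)
          (poch a n * poch c n / (poch d n * (n`!)%:R) * z ^+ n)).

(* Gauss hypergeometric function 2F1(a,c;d;z): the power series for |z| < 1,
   and for z <= -1 its (principal-branch) analytic continuation, given by
   the Pfaff transformation  (1-z)^(-a) 2F1(a, d-c; d; z/(z-1)),
   where z/(z-1) lies in (0,1).  Both formulas agree on (-1,0).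
   (Values for z >= 1 are irrelevant here and set to 0.) *)
Definition hyp2F1 (a c d z : R) : R :=
  if `|z| < 1 then hyp2F1_series a c d z
  else if z < 0 then (1 - z) `^ (- a) * hyp2F1_series a (d - c) d (z / (z - 1))
  else 0.

Definition K_DSD (alpha beta alphat betat b p q : R) : R :=
  (b * betat / beta) `^ q / Betaf p q * (Gammaf alphat / Gammaf (q + alphat))
  * (Gammaf (q + alpha) / Gammaf alpha).

Definition f_DSD (alpha beta alphat betat b p q s : R) : R :=
  K_DSD alpha beta alphat betat b p q * s `^ (- q - 1)
  * hyp2F1 (q + alpha) (q + p) (q + alphat) (- (b * betat / (s * beta))).

End defs.

(* Main.v *)
Require Import Defs.
From HB Require Import structures.
From mathcomp Require Import all_boot all_order all_algebra.
From mathcomp Require Import all_classical all_reals all_analysis.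
From mathcomp Require Import measurable_realfun.
From mathcomp Require Import ring lra.
Import Order.TTheory GRing.Theory Num.Theory.
Import numFieldNormedType.Exports.
Local Open Scope classical_set_scope.
Local Open Scope ring_scope.

(** For 0 < c <= d there are a weight h and a function t with values in (0,1] on
    (0,oo) such that t has the law Beta(c, d - c) (the unit mass at 1 if c = d)
    under h.  Integrating the binomial series of (1 - z t)^(-a) term by term,
    with 1 - t in place of t for the Pfaff branch, gives
      2F1(a,c;d;-x) = int h (1 + x t)^(-a)      for every x > 0, hence
      Gamma(a) 2F1(a,c;d;-x) = int_0^oo r^(a-1) e^(-r) M(r x) dr,
    where M(x) = int h e^(-x t) is Kummer's function 1F1(c;d;-x).  With
    a = q + alpha, c = q + p, d = q + alphat, Tonelli's theorem then reduces both
    integrals of f_DSD to inverse-gamma integrals of M, which are evaluated by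
    int h (1 + x t)^(-d) = (1 + x)^(-c) and by the moment int h t^(-q).  In the
    mixture the remaining integral over r is F20_pdf after y = beta v / r. *)

(** * Decreasing changes of variables on the half-line *)

Section integrals_on_posR.
Variable R : realType.
Implicit Types (f g h F G : R -> R) (E : set R).

(** Valued in the extended reals, so that integrals can be compared before they are known to be
    finite. *)
Definition posI f : \bar R := (\int[@lebesgue_measure R]_(x in @posR R) (f x)%:E)%E.

Lemma posRE (x : R) : @posR R x = (0 < x) :> Prop.
Proof. by rewrite /posR /= in_itv/= andbT. Qed.

Lemma measurable_posR : measurable (@posR R).
Proof. exact: measurable_itv. Qed.

(** The compact case is applied on the segments [1/(n+1), n+1]. These exhaust the half-line, their
    images under [F] exhaust [E], and monotone convergence passes to the limit on both sides. *)
Lemma decreasing_substitution F f G E :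
    (forall x : R, 0 < x -> is_derive x 1 F (- f x)) ->
    (forall x : R, 0 < x -> {for x, continuous f}) ->
    (forall x y : R, 0 < x -> x < y -> F y < F x) ->
    (forall y, E y <-> exists2 x : R, 0 < x & F x = y) ->
    (forall y, E y -> {for y, continuous G}) ->
    (forall y, E y -> 0 <= G y) ->
  (\int[@lebesgue_measure R]_(y in E) (G y)%:E)%E = posI (fun x => G (F x) * f x).
Proof.
move=> dF cf decF EP cG G0.
pose a n : R := n.+1%:R^-1; pose b n : R := n.+1%:R.
have a0 n : 0 < a n by rewrite invr_gt0 ltr0n.
have ab n : a n <= b n.
  rewrite (@le_trans _ _ 1) ?ler1n//.
  by rewrite invf_le1 ?ler1n ?ltr0n.
have decF' (x y : R) : 0 < x -> x <= y -> F y <= F x.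
  by move=> x0; rewrite le_eqVlt => /predU1P[->//|xy]; exact/ltW/decF.
have cF (x : R) : 0 < x -> {for x, continuous F}.
  move=> x0; apply/differentiable_continuous/derivable1_diffP.
  by have [] := dF _ x0.
have EI n : `[F (b n), F (a n)]%classic `<=` E.
  move=> y /=; rewrite in_itv/= => /andP[y1 y2].
  have [||c] := @IVT _ F (a n) (b n) y (ab n).
  - apply/continuous_in_subspaceT => x; rewrite inE/= in_itv/= => /andP[xa _].
    exact/cF/(lt_le_trans (a0 n)).
  - by rewrite min_r ?max_l ?y1//; exact: decF'.
  - rewrite in_itv/= => /andP[ca _] Fc; apply/EP; exists c => //.
    exact: lt_le_trans ca.
have large (x : R) : 0 < x -> exists n, a n <= x <= b n.
  move=> x0; exists (Num.bound x + Num.bound x^-1)%N.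
  have h1 := archi_boundP (ltW x0).
  have h2 : x^-1 < (Num.bound x^-1)%:R by apply: archi_boundP; rewrite invr_ge0 ltW.
  apply/andP; split.
    rewrite /a -[leRHS]invrK lef_pV2 ?posrE ?invr_gt0 ?ltr0n//.
    by apply: (le_trans (ltW h2)); rewrite ler_nat (leq_trans (leq_addl (Num.bound x) _)).
  by apply: (le_trans (ltW h1)); rewrite ler_nat -addnS leq_addr.
have ban n m : (n <= m)%N -> b n <= b m by move=> nm; rewrite ler_nat ltnS.
have aan n m : (n <= m)%N -> a m <= a n.
  by move=> nm; rewrite lef_pV2 ?posrE ?ltr0n//; exact: ban.
have EU : E = \bigcup_n `[F (b n), F (a n)]%classic.
  apply/seteqP; split => [y /EP[x x0 <-]|y [n _ /EI]//].
  have [n /andP[ax xb]] := large _ x0.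
  exists n => //=; rewrite in_itv/= !decF'//.
have PU : @posR R = \bigcup_n `[a n, b n]%classic.
  apply/seteqP; split => [x|x [n _]]; rewrite posRE.
    by move=> /large[n axb]; exists n => //=; rewrite in_itv.
  by rewrite /= in_itv/= => /andP[ax _]; exact: lt_le_trans ax.
have dFE (x : R) : 0 < x -> F^`()%classic x = - f x.
  by move=> x0; rewrite derive1E; have [_ ->] := dF _ x0.
have cdF (x : R) : 0 < x -> F^`()%classic y @[y --> x] --> F^`()%classic x.
  move=> x0; rewrite dFE//.
  have : - f y @[y --> x] --> - f x by apply: cvgN; exact: cf.
  apply: cvg_trans.
  apply: near_eq_cvg; near=> y; rewrite dFE//; near: y; exact: lt_nbhsr.
(* [F] decreases, so its derivative -f is nonpositive; monotone convergence for the transformed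
   integrand relies on this sign. *)
have f0 (x : R) : 0 < x -> 0 <= f x.
  move=> x0; rewrite -oppr_le0 -dFE//.
  apply: (@decr_derive1_le0_itvy _ F false 0).
  - by move=> y; rewrite inE/= in_itv/= andbT => /dF[].
  - move=> y z; rewrite !in_itv/= !andbT => y0 z0; exact: decF.
  - by rewrite in_itv/= x0.
have mG n : measurable_fun `[F (b n), F (a n)]%classic (fun x : R => (G x)%:E).
  apply/measurable_EFinP; apply: subspace_continuous_measurable_fun => //.
  apply/continuous_in_subspaceT => x; rewrite inE => /EI Ex; exact: cG.
have mGF n : measurable_fun `[a n, b n]%classic (fun x : R => (G (F x) * f x)%:E).
  apply/measurable_EFinP; apply: subspace_continuous_measurable_fun => //.
  apply/continuous_in_subspaceT => x; rewrite inE/= in_itv/= => /andP[ax _].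
  have x0 := lt_le_trans (a0 n) ax.
  apply: cvgM; last exact: cf.
  by apply: (@continuous_comp _ _ _ F G); [exact: cF|apply: cG; apply/EP; exists x].
have step n : (\int[@lebesgue_measure R]_(y in `[F (b n), F (a n)]) (G y)%:E =
    \int[@lebesgue_measure R]_(x in `[a n, b n]) (G (F x) * f x)%:E)%E.
  rewrite (@integration_by_substitution_decreasing _ F G (a n) (b n)) //.
  - apply: eq_integral => x; rewrite inE/= in_itv/= => /andP[ax _].
    by rewrite !fctE dFE ?opprK// (lt_le_trans _ ax).
  - move=> x y; rewrite !in_itv/= => /andP[ax _] /andP[ay _] xy; apply: decF => //.
    exact: lt_le_trans ay.
  - move=> x; rewrite in_itv/= => /andP[ax _]; apply: cdF; exact: lt_trans ax.
  - apply/cvg_ex; exists (F^`()%classic (a n)); apply: cvg_at_right_filter; exact: cdF.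
  - apply/cvg_ex; exists (F^`()%classic (b n)); apply: cvg_at_left_filter; apply: cdF.
    exact: lt_le_trans (ab n).
  - split.
    + move=> x; rewrite in_itv/= => /andP[ax _].
      by have [] := dF _ (lt_trans (a0 n) ax).
    + by apply: cvg_at_right_filter; exact: cF.
    + by apply: cvg_at_left_filter; apply: cF; exact: lt_le_trans (ab n).
  - by apply/continuous_in_subspaceT => x; rewrite inE => /EI Ex; exact: cG.
rewrite /posI EU PU.
have h1 : (\int[@lebesgue_measure R]_(y in `[F (b n), F (a n)]) (G y)%:E)%E @[n --> \oo] -->
    (\int[@lebesgue_measure R]_(y in \bigcup_n `[F (b n), F (a n)]%classic) (G y)%:E)%E.
  apply: ge0_nondecreasing_set_cvg_integral => //.
  - apply/nondecreasing_seqP => n; rewrite subsetEset => x /=.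
    rewrite !in_itv/= => /andP[x1 x2]; apply/andP; split.
      by apply: le_trans x1; apply: decF'; rewrite ?ltr0n// ban.
    by apply: (le_trans x2); apply: decF'; rewrite ?a0// aan.
  - by move=> n x /EI Ex /=; rewrite lee_fin G0.
have h2 : (\int[@lebesgue_measure R]_(x in `[a n, b n]) (G (F x) * f x)%:E)%E @[n --> \oo] -->
    (\int[@lebesgue_measure R]_(x in \bigcup_n `[a n, b n]%classic) (G (F x) * f x)%:E)%E.
  apply: ge0_nondecreasing_set_cvg_integral => //.
  - apply/nondecreasing_seqP => n; rewrite subsetEset => x /=.
    rewrite !in_itv/= => /andP[x1 x2]; rewrite (le_trans _ x1) ?aan//.
    by rewrite (le_trans x2) ?ban.
  - move=> n x /=; rewrite in_itv/= => /andP[ax _]; have x0 := lt_le_trans (a0 n) ax.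
    by rewrite lee_fin mulr_ge0 ?f0// G0//; apply/EP; exists x.
apply: (cvg_unique _ h1) => //.
by rewrite (funext step).
Unshelve. all: end_near. Qed.
End integrals_on_posR.
Arguments posI {R} f.

(** * Measurability of inverses and of composite integrands *)

Lemma measurable_invr (R : realType) : measurable_fun [set: R] (fun x : R => x^-1).
Proof.
(* This reduces the inverse to a real power; at 0 both sides vanish because 0^-1 = 0. *)
have -> : (fun x : R => x^-1) = (fun x => x * `|x| `^ (-2)).
  apply/funext => x; have [->|x0] := eqVneq x 0; first by rewrite invr0 mul0r.
  rewrite powRN -[2]/(2%:R) powR_mulrn// real_normK ?num_real// expr2 invfM.
  by rewrite mulrA divff// mul1r.
apply: measurable_funM => //.
by apply: (measurableT_comp (@measurable_powR R (-2))); exact: normr_measurable.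
Qed.

(** Decomposes a goal along the syntax of the function; the clause on a hypothesis [H] handles
    abstract functions such as [h], [t] and [M]. *)
Ltac measurability := rewrite /=; repeat match goal with
  | |- measurable_fun _ (fun x => x.1) => exact: measurable_fst
  | |- measurable_fun _ (fun x => x.2) => exact: measurable_snd
  | |- measurable_fun _ (fun x => x) => exact: measurable_id
  | |- measurable_fun _ (fun _ => ?c) => exact: measurable_cst
  | |- measurable_fun _ (fun x => _ * _) => apply: measurable_funM
  | |- measurable_fun _ (fun x => _ + - _) => apply: measurable_funB
  | |- measurable_fun _ (fun x => _ + _) => apply: measurable_funD
  | |- measurable_fun _ (fun x => - _) => apply: measurable_funN
  | |- measurable_fun _ (fun x => _ ^-1) =>
      apply: (measurableT_comp (@measurable_invr _))
  | |- measurable_fun _ (fun x => expR _) =>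
      apply: (measurableT_comp (@measurable_expR _))
  | |- measurable_fun _ (fun x => _ `^ ?p) =>
      apply: (measurableT_comp (@measurable_powR _ p))
  | |- measurable_fun _ (fun x => _ ^+ ?n) => apply: measurable_funX
  | |- measurable_fun _ (GRing.add ?c) =>
      apply: (@measurable_funD _ _ _ _ (fun=> c) id)
  | |- measurable_fun _ (GRing.mul _) => exact: mulrl_measurable
  | |- measurable_fun _ -%R => exact: oppr_measurable
  | |- measurable_fun _ (@GRing.inv _) => exact: measurable_invr
  | |- measurable_fun _ id => exact: measurable_id
  | H : measurable_fun _ ?t |- measurable_fun _ (fun x => ?t _) =>
      apply: (measurableT_comp H)
  end.

(** * Tonelli's theorem on the half-line *)

Section posI_theory.
Variable R : realType.
Implicit Types (f g h : R -> R).

Lemma eq_posI f g : (forall x : R, 0 < x -> f x = g x) -> posI f = posI g.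
Proof.
by move=> fg; apply: eq_integral => x; rewrite inE posRE => /fg ->.
Qed.

Lemma posI_ge0 f : (forall x : R, 0 < x -> 0 <= f x) -> (0 <= posI f)%E.
Proof. by move=> f0; apply: integral_ge0 => x; rewrite posRE lee_fin => /f0. Qed.

Lemma posIZl (k : R) f : 0 <= k -> measurable_fun [set: R] f ->
  (forall x : R, 0 < x -> 0 <= f x) -> posI (fun x => k * f x) = (k%:E * posI f)%E.
Proof.
move=> k0 mf f0; rewrite /posI -ge0_integralZl_EFin//.
- exact: measurable_posR.
- by move=> x; rewrite posRE lee_fin => /f0.
- by apply/measurable_EFinP; exact: measurable_funTS.
Qed.

Lemma le_posI f g : measurable_fun [set: R] f -> measurable_fun [set: R] g ->
  (forall x : R, 0 < x -> 0 <= f x <= g x) -> (posI f <= posI g)%E.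
Proof.
move=> mf mg fg; apply: ge0_le_integral.
- exact: measurable_posR.
- by move=> x; rewrite posRE lee_fin => /fg /andP[].
- by apply/measurable_EFinP; exact: measurable_funTS.
- by apply/measurable_EFinP; exact: measurable_funTS.
- by move=> x; rewrite posRE lee_fin => /fg /andP[].
Qed.

(** Indicators move a double integral over the quadrant to the whole plane, where Tonelli's theorem
    is applied. *)
Let patch2 (f : R -> R -> R) (z : R * R) : \bar R :=
  (f z.1 z.2 * \1_(@posR R) z.1 * \1_(@posR R) z.2)%:E.

Let measurable_patch2 (f : R -> R -> R) :
  measurable_fun [set: R * R] (fun z => f z.1 z.2) -> measurable_fun [set: R * R] (patch2 f).
Proof.
move=> mf; apply/measurable_EFinP; apply: measurable_funM; first apply: measurable_funM => //.
- apply: (@measurableT_comp _ _ _ _ _ _ (\1_(@posR R) : R -> R)) => //.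
  by apply: measurable_indic; exact: measurable_posR.
- apply: (@measurableT_comp _ _ _ _ _ _ (\1_(@posR R) : R -> R)) => //.
  by apply: measurable_indic; exact: measurable_posR.
Qed.

Let patch2_ge0 (f : R -> R -> R) : (forall x y, 0 <= f x y) ->
  forall z, (0 <= patch2 f z)%E.
Proof. by move=> f0 z; rewrite lee_fin !mulr_ge0. Qed.

Let posI_indic f (k : R) :
  (\int[@lebesgue_measure R]_y (f y * k * \1_(@posR R) y)%:E)%E = posI (fun y => f y * k).
Proof.
rewrite /posI [RHS]integral_mkcond; apply: eq_integral => y _.
by rewrite patchE indicE; case: ifP => _; rewrite ?mulr1 ?mulr0.
Qed.

(** Tonelli's theorem as a device for proving two single integrals equal: it suffices to exhibit a
    nonnegative kernel that has both integrands as its partial integrals. *)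
Lemma exchange_posI (f : R -> R -> R) (g h : R -> R) :
    measurable_fun [set: R * R] (fun z => f z.1 z.2) ->
    (forall x y, 0 <= f x y) ->
    (forall x : R, 0 < x -> posI (f x) = (g x)%:E) ->
    (forall y : R, 0 < y -> posI (f ^~ y) = (h y)%:E) ->
  posI g = posI h.
Proof.
move=> mf f0 fg fh.
have := @fubini_tonelli _ _ _ _ R (@lebesgue_measure R) (@lebesgue_measure R) (patch2 f)
  (measurable_patch2 _ mf) (patch2_ge0 _ f0).
have E1 (u : R -> R) (v : R -> R -> R) : (forall x : R, 0 < x -> posI (v x) = (u x)%:E) ->
    (\int[@lebesgue_measure R]_x \int[@lebesgue_measure R]_y
       (v x y * \1_(@posR R) x * \1_(@posR R) y)%:E)%E = posI u.
  move=> uv; rewrite /posI [RHS]integral_mkcond; apply: eq_integral => x _.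
  rewrite posI_indic patchE indicE; case: ifP => [|_].
    by rewrite inE posRE => /uv <-; under eq_posI do rewrite mulr1.
  under eq_posI do rewrite mulr0.
  by rewrite /posI integral0.
rewrite /patch2/= (E1 g f fg) => ->.
have <- := E1 h (fun y x => f x y) fh.
by apply: eq_integral => y _; apply: eq_integral => x _; rewrite mulrAC.
Qed.

Lemma measurable_fun_posI (f : R -> R -> R) :
  measurable_fun [set: R * R] (fun z => f z.1 z.2) -> (forall x y, 0 <= f x y) ->
  measurable_fun [set: R] (fun x => posI (f x)).
Proof.
move=> mf f0.
(* The factor 1 gives the integrand the shape that [posI_indic] expects. *)
pose f1 (z : R * R) := (f z.1 z.2 * 1 * \1_(@posR R) z.2)%:E.
have mf1 : measurable_fun [set: R * R] f1.
  apply/measurable_EFinP; apply: measurable_funM; first by apply: measurable_funM.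
  apply: (@measurableT_comp _ _ _ _ _ _ (\1_(@posR R) : R -> R)) => //.
  by apply: measurable_indic; exact: measurable_posR.
have f10 z : (0 <= f1 z)%E by rewrite lee_fin !mulr_ge0.
have := @measurable_fun_fubini_tonelli_F _ _ _ _ R (@lebesgue_measure R) f1 mf1 f10.
congr measurable_fun; apply/funext => x.
by rewrite /fubini_F /f1/= posI_indic; under eq_posI do rewrite mulr1.
Qed.

End posI_theory.

(** * Scaling, inversion, and finiteness of the Gamma integral from 1 on *)

Section gamma_function.
Variable R : realType.
Implicit Types (f g h : R -> R) (a b c k p q x y : R).

Lemma continuous_powR a x : 0 < x -> {for x, continuous (fun y : R => y `^ a)}.
Proof.
move=> x0; apply/differentiable_continuous/derivable1_diffP.
by apply: derivable_powR; rewrite in_itv/= x0.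
Qed.

Lemma continuous_expRN x : {for x, continuous (fun y : R => expR (- y))}.
Proof.
apply: (@continuous_comp _ _ _ (fun x : R => - x) expR); first exact: opp_continuous.
exact: continuous_expR.
Qed.

Lemma posI_inv k g : 0 < k -> (forall x : R, 0 < x -> {for x, continuous g}) ->
  (forall x : R, 0 < x -> 0 <= g x) ->
  posI g = posI (fun x => g (k / x) * (k * x ^- 2)).
Proof.
move=> k0 cg g0.
apply: (@decreasing_substitution _ (fun x => k / x) (fun x => k * x ^- 2)).
- move=> x x0; have xn0 : x != 0 by rewrite gt_eqF.
  apply: is_derive_eq; first by apply: is_deriveM; exact: is_deriveV.
  by rewrite scaler0 addr0 /GRing.scale/= mulr1 mulrN.
- move=> x x0; apply: cvgM; first exact: cvg_cst.
  apply: cvgV; first by rewrite expf_eq0/= gt_eqF.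
  exact: exprn_continuous.
- by move=> x y x0 xy; rewrite ltr_pM2l// ltf_pV2 ?posrE// (lt_trans x0).
- move=> y; rewrite posRE; split => [y0|[x x0 <-]]; last by rewrite divr_gt0.
  by exists (k / y); rewrite ?divr_gt0// invf_div mulrCA divff ?mulr1// gt_eqF.
- by move=> y; rewrite posRE; exact: cg.
- by move=> y; rewrite posRE; exact: g0.
Qed.

(** Scaling by k is the composition of the two decreasing maps x -> k/x and x -> 1/x. *)
Lemma posI_scale k g : 0 < k -> (forall x : R, 0 < x -> {for x, continuous g}) ->
  (forall x : R, 0 < x -> 0 <= g x) ->
  posI g = posI (fun x => g (k * x) * k).
Proof.
move=> k0 cg g0; rewrite (posI_inv _ _ k0 cg g0).
rewrite [RHS](posI_inv 1) //; last 2 first.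
- move=> x x0; apply: cvgM; last exact: cvg_cst.
  apply: (@continuous_comp _ _ _ (fun x => k * x) g); first exact: mulrl_continuous.
  by apply: cg; rewrite mulr_gt0.
- by move=> x x0; apply: mulr_ge0; [apply: g0; exact: mulr_gt0|exact: ltW].
by apply: eq_posI => x x0; rewrite !mul1r mulrA.
Qed.

(** The substitution y = e^(-x) identifies the integral with the length of (0,1). *)
Lemma posI_expRN : posI (fun x : R => expR (- x)) = 1%E.
Proof.
rewrite (_ : posI _ = posI (fun x : R => 1 * expR (- x))); last first.
  by apply: eq_posI => x _; rewrite mul1r.
transitivity (\int[@lebesgue_measure R]_(x in `]0%R, 1%R[) (1%:E : \bar R))%E; last first.
  rewrite integral_cst// mul1e; apply: (etrans (lebesgue_measure_itv `]0%R, 1%R[)).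
  by rewrite /= lte_fin ltr01 oppr0 adde0.
apply/esym; apply: (@decreasing_substitution _ (fun x : R => expR (- x))
  (fun x : R => expR (- x)) (fun=> 1)).
- by move=> x x0; apply: is_derive_eq; rewrite /GRing.scale/= ?mulr1 ?mulN1r ?mulrN1.
- by move=> x _; exact: continuous_expRN.
- by move=> x y x0 xy; rewrite ltr_expR ltrN2.
- move=> y /=; rewrite in_itv/=; split => [/andP[y0 y1]|[x x0 <-]]; last first.
    by rewrite expR_gt0 expR_lt1 oppr_lt0.
  exists (- ln y); last by rewrite opprK lnK.
  by rewrite oppr_gt0 ln_lt0// y0.
- by move=> y _; exact: cvg_cst.
- by [].
Qed.

(** [Gammaf] is the [fine] part of this value and would be 0 if the integral were infinite, so
    finiteness has to be established before identities can be stated for [Gammaf]. *)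
Definition gammaI a : \bar R := posI (fun x => x `^ (a - 1) * expR (- x)).

Lemma GammafE a : Gammaf a = fine (gammaI a).
Proof. by []. Qed.

Lemma gammaI_ge0 a : (0 <= gammaI a)%E.
Proof. by apply: posI_ge0 => x _; rewrite mulr_ge0 ?powR_ge0 ?expR_ge0. Qed.

Lemma gammaI_scale a k : 0 < k ->
  posI (fun x => x `^ (a - 1) * expR (- (k * x))) = ((k `^ (- a))%:E * gammaI a)%E.
Proof.
move=> k0; rewrite /gammaI [in RHS](posI_scale k)//; last 2 first.
- move=> x x0; apply: cvgM; first exact: continuous_powR.
  exact: continuous_expRN.
- by move=> x _; rewrite mulr_ge0 ?powR_ge0 ?expR_ge0.
rewrite -posIZl ?powR_ge0//; first last.
- by move=> x x0; rewrite !mulr_ge0 ?powR_ge0 ?expR_ge0 ?ltW.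
- by measurability.
apply: eq_posI => x x0.
rewrite powRM ?ltW// (@powRB _ k) ?powRr1 ?ltW//; last by rewrite (gt_eqF k0) implybT.
rewrite powRN; field.
by rewrite ?gt_eqF ?powR_gt0// gt_eqF.
Qed.

(** The integrand is at most C e^(-x/2), because e^(x/2) >= 1 + (x/2)^(n+1)/(n+1)! outgrows x^(a-1)
    once n > a. *)
Lemma gammaI_fin_ge1 a : 1 <= a -> (gammaI a < +oo)%E.
Proof.
move=> a1; pose n := Num.bound a.
have an : a < n%:R by apply: archi_boundP; rewrite (le_trans _ a1).
(* Chosen so that C (1 + (x/2)^(n+1)/(n+1)!) = C + x^(n+1): the first summand dominates x^(a-1) for
   x <= 1, the second for x > 1. *)
pose C : R := 2 ^+ n.+1 * n.+1`!%:R.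
have C1 : 1 <= C.
  by rewrite mulr_ege1// ?ler1n ?fact_gt0// exprn_ege1// ler1n.
have le1 : (gammaI a <= posI (fun x => C * expR (- (2^-1 * x)))%R)%E.
  apply: le_posI; [by measurability|by measurability|move=> x x0].
  rewrite mulr_ge0 ?powR_ge0 ?expR_ge0//=.
  rewrite [X in X <= _](_ : _ =
    x `^ (a - 1) * expR (- (2^-1 * x)) * expR (- (2^-1 * x))); last first.
    by rewrite -mulrA -expRD; congr (_ * expR _); lra.
  rewrite ler_wpM2r ?expR_ge0// expRN ler_pdivrMr ?expR_gt0//.
  have := @expR_ge1Dxn R (2^-1 * x) n; have -> : 0 <= 2^-1 * x by rewrite mulr_ge0// ltW.
  move=> /(_ isT) le2.
  apply: le_trans (_ : C * (1 + (2^-1 * x) ^+ n.+1 / n.+1`!%:R) <= _); last first.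
    by rewrite ler_wpM2l// (le_trans _ C1).
  rewrite mulrDr mulr1 [X in _ <= _ + X](_ : _ = x ^+ n.+1); last first.
    rewrite /C exprMn exprVn; field.
    by rewrite ?expf_neq0 ?pnatr_eq0 -?lt0n ?fact_gt0.
  have [x1|x1] := leP x 1.
    rewrite (@le_trans _ _ 1)//; last by rewrite ler_wpDr// exprn_ge0// ltW.
    by rewrite -[leRHS](powRr0 x) ger_powR ?x0// subr_ge0.
  rewrite ler_wpDl ?(le_trans _ C1)// -powR_mulrn ?(ltW x0)// ler_powR ?(ltW x1)//.
  by rewrite -natr1; lra.
apply: (le_lt_trans le1).
rewrite posIZl; [|by rewrite (le_trans _ C1)|by measurability|by move=> *; exact: expR_ge0].
have := gammaI_scale 1 2^-1; rewrite invr_gt0 ltr0n => /(_ isT).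
rewrite (_ : posI _ = posI (fun x => expR (- (2^-1 * x)))); last first.
  by apply: eq_posI => x x0; rewrite subrr powRr0 mul1r.
rewrite /gammaI (_ : posI (fun x => x `^ (1 - 1) * _) = 1%E); last first.
  by rewrite -posI_expRN; apply: eq_posI => x x0; rewrite subrr powRr0 mul1r.
by move=> ->; rewrite mule1 -EFinM ltry.
Qed.

End gamma_function.

(** * Functional equation and positivity of Gamma, and the Beta integral *)

Section gamma_identities.
Variable R : realType.
Implicit Types (f g h : R -> R) (a b c k p q x y : R).

(** Products of real powers are compared below as exponentials of combinations of logarithms, whose
    exponents [ring] can match. *)
Lemma powR_expR x a : 0 < x -> x `^ a = expR (a * ln x).
Proof. by move=> x0; rewrite /powR gt_eqF. Qed.

Lemma exprV_expR x n : 0 < x -> x ^- n = expR (- (n%:R * ln x)).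
Proof. by move=> x0; rewrite expRN expRM_natl lnK// posrE. Qed.

Lemma gammaI1 : gammaI R 1 = 1%E.
Proof.
by rewrite -posI_expRN; apply: eq_posI => x x0; rewrite subrr powRr0 mul1r.
Qed.

(* [gammaI b] may still be infinite here: the case [a = 1] yields its finiteness. *)
Lemma gammaI_mul a b (A C : R) : gammaI R a = A%:E -> gammaI R (a + b) = C%:E ->
  (C%:E * posI (fun w => w `^ (a - 1) * (1 + w) `^ (- (a + b)))%R = A%:E * gammaI R b)%E.
Proof.
move=> gA gC.
have A0 : 0 <= A by rewrite -lee_fin -gA gammaI_ge0.
have C0 : 0 <= C by rewrite -lee_fin -gC gammaI_ge0.
rewrite -posIZl//; last 2 first.
- by measurability.
- by move=> x x0; rewrite mulr_ge0 ?powR_ge0.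
rewrite -posIZl//; last 2 first.
- by measurability.
- by move=> x x0; rewrite mulr_ge0 ?powR_ge0 ?expR_ge0.
(* Integrating this kernel in r gives a gamma integral of rate 1 + w; integrating it in w gives one
   of rate r. *)
apply: (@exchange_posI _ (fun w r => w `^ (a - 1) * (r `^ (a + b - 1) * expR (- ((1 + w) * r))))).
- by measurability.
- by move=> x y; rewrite !mulr_ge0 ?powR_ge0 ?expR_ge0.
- move=> w w0; rewrite posIZl ?powR_ge0//; last 2 first.
  + by measurability.
  + by move=> x x0; rewrite !mulr_ge0 ?powR_ge0 ?expR_ge0.
  by rewrite gammaI_scale ?addr_gt0// gC -!EFinM; congr EFin; ring.
- move=> r r0.
  rewrite (eq_posI _ _ (fun w =>
    r `^ (a + b - 1) * expR (- r) * (w `^ (a - 1) * expR (- (r * w))))); last first.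
    by move=> w w0; rewrite mulrDl mul1r opprD expRD [w * r]mulrC; ring.
  rewrite posIZl ?mulr_ge0 ?powR_ge0 ?expR_ge0//; last 2 first.
  + by measurability.
  + by move=> x x0; rewrite !mulr_ge0 ?powR_ge0 ?expR_ge0.
  rewrite gammaI_scale// gA -!EFinM; congr EFin.
  have -> : r `^ (b - 1) = r `^ (a + b - 1) * r `^ (- a).
    by rewrite !powR_expR// -expRD; congr expR; ring.
  by ring.
Qed.

Lemma is_derive_shift x : is_derive x 1 (fun w : R => 1 + w) 1.
Proof.
rewrite -[X in is_derive _ _ _ X]add0r.
exact: (is_deriveD (is_derive_cst (1 : R) x 1) (is_derive_id x 1)).
Qed.

(** The substitution y = (1 + w)^(-a) maps the half-line onto (0,1), with -dy = a (1 + w)^(-(1 + a))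
    dw. *)
Lemma posI_onem_powR a : 0 < a -> posI (fun w => (1 + w) `^ (- (1 + a))) = (a^-1)%:E.
Proof.
move=> a0.
have E : posI (fun w => 1 * (a * (1 + w) `^ (- (1 + a)))) = 1%E.
  transitivity (\int[@lebesgue_measure R]_(x in `]0%R, 1%R[) (1%:E : \bar R))%E; last first.
    rewrite integral_cst// mul1e; apply: (etrans (lebesgue_measure_itv `]0%R, 1%R[)).
    by rewrite /= lte_fin ltr01 oppr0 adde0.
  apply/esym; apply: (@decreasing_substitution _ (fun w : R => (1 + w) `^ (- a)) _ (fun=> 1)).
  - move=> x x0; have x1 : 0 < 1 + x by rewrite addr_gt0.
    have h1 := is_derive_shift x.
    have h2 : is_derive (1 + x) 1 (fun u : R => u `^ (- a)) (- a * (1 + x) `^ (- a - 1)).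
      exact: is_derive1_powR.
    have := is_derive1_comp h2 h1; rewrite mulr1 => h3.
    by rewrite -mulNr opprD [- 1 - a]addrC; exact: h3.
  - move=> x x0; apply: cvgM; first exact: cvg_cst.
    apply: (@continuous_comp _ _ _ (fun w : R => 1 + w) (fun u : R => u `^ (- (1 + a)))).
      by apply: cvgD; [exact: cvg_cst|exact: cvg_id].
    by apply: continuous_powR; rewrite addr_gt0.
  - move=> x y x0 xy; have y0 := lt_trans x0 xy.
    rewrite !powRN ltf_pV2 ?posrE ?powR_gt0 ?addr_gt0//.
    by apply: gt0_ltr_powR; rewrite // ?nnegrE ?ltrD2l// addr_ge0// ltW.
  - move=> y /=; rewrite in_itv/=; split => [/andP[y0 y1]|[x x0 <-]]; last first.
      rewrite powR_gt0 ?addr_gt0//= powR_expR ?addr_gt0// expR_lt1.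
      by rewrite mulNr oppr_lt0 mulr_gt0// ln_gt0// ltrDl.
    (* The preimage of y is y^(-1/a) - 1. *)
    exists (expR (- a^-1 * ln y) - 1).
      by rewrite subr_gt0 expR_gt1 mulNr oppr_gt0 pmulr_rlt0 ?invr_gt0// ln_lt0// y0.
    rewrite addrCA subrr addr0 powR_expR ?expR_gt0// expRK mulrA.
    by rewrite mulrNN divff ?gt_eqF// mul1r lnK.
  - by move=> y _; exact: cvg_cst.
  - by [].
have E2 : posI (fun w => 1 * (a * (1 + w) `^ (- (1 + a)))) =
    (a%:E * posI (fun w => (1 + w) `^ (- (1 + a)))%R)%E.
  rewrite -posIZl ?ltW//.
  + by apply: eq_posI => x _; rewrite mul1r.
  + by measurability.
  + by move=> x _; rewrite powR_ge0.
by rewrite -[RHS]mule1 -E E2 muleA -EFinM mulVf ?gt_eqF// mul1e.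
Qed.

(** [gammaI_mul] with first parameter 1 expresses the integral at a through the one at 1 + a, which
    is finite as 1 + a >= 1. *)
Lemma gammaI_fin_num a : 0 < a -> gammaI R a \is a fin_num.
Proof.
move=> a0.
have fin : gammaI R (1 + a) \is a fin_num.
  by rewrite ge0_fin_numE ?gammaI_ge0// gammaI_fin_ge1// lerDl ltW.
have := @gammaI_mul 1 a 1 _ gammaI1 (esym (fineK fin)).
rewrite mul1e => <-.
rewrite (eq_posI _ _ (fun w => (1 + w) `^ (- (1 + a)))).
  by rewrite posI_onem_powR.
by move=> x x0; rewrite subrr powRr0 mul1r.
Qed.

Lemma gammaIE a : 0 < a -> gammaI R a = (Gammaf a)%:E.
Proof. by move=> a0; rewrite GammafE fineK// gammaI_fin_num. Qed.

Lemma Gammaf_ge0 a : 0 <= Gammaf a.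
Proof. by rewrite GammafE fine_ge0// gammaI_ge0. Qed.

(** Read off from [gammaI_mul] with first parameter 1, where the remaining integral equals 1/a. *)
Lemma GammafS a : 0 < a -> Gammaf (a + 1) = a * Gammaf a.
Proof.
move=> a0; have a10 : 0 < 1 + a by rewrite addr_gt0.
have := @gammaI_mul 1 a 1 _ gammaI1 (gammaIE _ a10).
rewrite mul1e (eq_posI _ _ (fun w => (1 + w) `^ (- (1 + a)))); last first.
  by move=> x x0; rewrite subrr powRr0 mul1r.
rewrite posI_onem_powR// gammaIE// -EFinM => -[<-].
by rewrite [1 + a]addrC; field; rewrite gt_eqF.
Qed.

(** For 0 < x <= 1, the bound ln y <= y - 1 puts e^(1-x) e^(-(2-x)y) below the integrand, and its
    integral is positive. The functional equation extends this to larger arguments by induction. *)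
Lemma Gammaf_gt0 a : 0 < a -> 0 < Gammaf a.
Proof.
have G1 x : 0 < x <= 1 -> 0 < Gammaf x.
  move=> /andP[x0 x1].
  have d0 : 0 < 2 - x by lra.
  have : (posI (fun y => expR (1 - x) * expR (- ((2 - x) * y)))%R <= gammaI R x)%E.
    apply: le_posI; [by measurability|by measurability|move=> y y0].
    rewrite mulr_ge0 ?expR_ge0//= powR_expR// -!expRD ler_expR.
    have : ln y <= y - 1.
      by have := expR_ge1Dx (ln y); rewrite lnK//; lra.
    by move=> h; nra.
  rewrite posIZl ?expR_ge0//; last by measurability.
  rewrite (eq_posI _ _ (fun y => y `^ (1 - 1) * expR (- ((2 - x) * y)))); last first.
    by move=> y y0; rewrite subrr powRr0 mul1r.
  rewrite gammaI_scale// gammaI1 mule1 gammaIE// -EFinM lee_fin.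
  by apply: lt_le_trans; rewrite mulr_gt0 ?expR_gt0 ?powR_gt0.
have Gn n : forall x, 0 < x <= n.+1%:R -> 0 < Gammaf x.
  elim: n => [|n IHn] x /andP[x0 xn]; first by apply: G1; rewrite x0.
  have [x1|x1] := leP x 1; first by apply: G1; rewrite x0.
  rewrite -[x](subrK 1) GammafS ?subr_gt0// mulr_gt0 ?subr_gt0//.
  by apply: IHn; rewrite subr_gt0 x1 lerBlDr natr1.
move=> a0; apply: (Gn (Num.bound a)); rewrite a0.
by rewrite ltW// (lt_le_trans (archi_boundP (ltW a0)))// ler_nat.
Qed.

Lemma posI_gamma a k : 0 < a -> 0 < k ->
  posI (fun x => x `^ (a - 1) * expR (- (k * x))) = (k `^ (- a) * Gammaf a)%:E.
Proof. by move=> a0 k0; rewrite gammaI_scale// gammaIE. Qed.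

(** The inverse-gamma integral: the inversion s -> 1/s applied to [posI_gamma]. *)
Lemma posI_inv_gamma a k : 0 < a -> 0 < k ->
  posI (fun s => s `^ (- a - 1) * expR (- (k / s))) = (k `^ (- a) * Gammaf a)%:E.
Proof.
move=> a0 k0; rewrite -(posI_gamma _ _ a0 k0) [RHS](posI_inv _ 1 _ ltr01).
- apply: eq_posI => s s0; rewrite !mul1r mulrAC; congr (_ * _).
  rewrite !powR_expR ?invr_gt0// lnV ?posrE// exprV_expR// -expRD.
  by congr expR; ring.
- move=> x x0; apply: cvgM; first exact: continuous_powR.
  apply: (@continuous_comp _ _ _ (fun y : R => k * y) (fun y => expR (- y))).
    exact: mulrl_continuous.
  exact: continuous_expRN.
- by move=> x _; rewrite mulr_ge0 ?powR_ge0 ?expR_ge0.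
Qed.

Lemma posI_beta a b : 0 < a -> 0 < b ->
  posI (fun w => w `^ (a - 1) * (1 + w) `^ (- (a + b))) =
  (Gammaf a * Gammaf b / Gammaf (a + b))%:E.
Proof.
move=> a0 b0; have ab0 : 0 < a + b by rewrite addr_gt0.
have := @gammaI_mul a b _ _ (gammaIE _ a0) (gammaIE _ ab0).
rewrite (gammaIE _ b0) -EFinM => E.
have G0 := gt_eqF (Gammaf_gt0 _ ab0).
by rewrite mulrC EFinM -E muleA -EFinM mulVf ?G0// mul1e.
Qed.

(** The substitution t = 1/(1 + w) leads to the beta prime integral [posI_beta]. There q is the
    exponent of w, whence the initial swap of p and q. *)
Lemma BetafE p q : 0 < p -> 0 < q -> Betaf p q = Gammaf p * Gammaf q / Gammaf (p + q).
Proof.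
move=> p0 q0; rewrite [p + q]addrC [Gammaf p * _]mulrC.
suff E : (\int[@lebesgue_measure R]_(t in `]0%R, 1%R[%classic)
    (t `^ (p - 1) * (1 - t) `^ (q - 1))%:E)%E = (Gammaf q * Gammaf p / Gammaf (q + p))%:E.
  by rewrite /Betaf /Rintegral E.
rewrite -(posI_beta _ _ q0 p0).
transitivity (posI (fun w => (1 + w)^-1 `^ (p - 1) * (1 - (1 + w)^-1) `^ (q - 1)
    * (1 + w) ^- 2)); last first.
  apply: eq_posI => w w0; have w1 : 0 < 1 + w by rewrite addr_gt0.
  have -> : 1 - (1 + w)^-1 = w * (1 + w)^-1 by field; rewrite gt_eqF.
  rewrite powRM ?invr_ge0 ?ltW// !powR_expR ?invr_gt0// lnV ?posrE//.
  by rewrite exprV_expR// -!expRD; congr expR; ring.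
apply: (@decreasing_substitution _ (fun w : R => (1 + w)^-1) (fun w => (1 + w) ^- 2)
  (fun t => t `^ (p - 1) * (1 - t) `^ (q - 1))).
- move=> x x0; have x1 : 1 + x != 0 by rewrite gt_eqF// addr_gt0.
  have h1 := is_derive_shift x.
  have := is_deriveV x1 h1.
  by rewrite /GRing.scale/= mulr1.
- move=> x x0; apply: cvgV; first by rewrite expf_eq0/= gt_eqF// addr_gt0.
  apply: (@continuous_comp _ _ _ (fun w : R => 1 + w) (fun u : R => u ^+ 2)).
    by apply: cvgD; [exact: cvg_cst|exact: cvg_id].
  exact: exprn_continuous.
- move=> x y x0 xy; have y0 := lt_trans x0 xy.
  by rewrite ltf_pV2 ?posrE ?addr_gt0// ltrD2l.
- move=> y /=; rewrite in_itv/=; split => [/andP[y0 y1]|[x x0 <-]]; last first.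
    by rewrite invr_gt0 invf_lt1 ?addr_gt0//= ltrDl.
  exists (y^-1 - 1); first by rewrite subr_gt0 invf_gt1.
  by rewrite addrCA subrr addr0 invrK.
- move=> y /=; rewrite in_itv/= => /andP[y0 y1]; apply: cvgM; first exact: continuous_powR.
  apply: (@continuous_comp _ _ _ (fun w : R => 1 - w) (fun u : R => u `^ (q - 1))).
    by apply: cvgB; [exact: cvg_cst|exact: cvg_id].
  by apply: continuous_powR; rewrite subr_gt0.
- by move=> y _; rewrite mulr_ge0 ?powR_ge0.
Qed.

End gamma_identities.

(** * Termwise integration, the binomial series and the hypergeometric series *)

Section series.
Variable R : realType.
Implicit Types (f g h t W L B : R -> R) (a b c d k p q x y z : R).

Lemma integrable_posI f : measurable_fun [set: R] f -> (forall x : R, 0 < x -> 0 <= f x) ->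
  (posI f < +oo)%E -> (@lebesgue_measure R).-integrable (@posR R) (fun x => (f x)%:E).
Proof.
move=> mf f0 fi; apply/integrableP; split.
  by apply/measurable_EFinP; exact: measurable_funTS.
apply: le_lt_trans fi; rewrite le_eqVlt; apply/predU1P; left.
apply: eq_integral => x; rewrite inE posRE => /f0 fx0.
by rewrite /= ger0_norm.
Qed.

(** Dominated convergence for partial sums against the weight [W]: the common majorant is [B], and
    [m n] is the weighted integral of [phi n]. It serves with powers r^n for the binomial series and
    with t^n for 2F1. *)
Lemma posI_series W L B (phi : nat -> R -> R) (u m : nat -> R) (l : R) :
    measurable_fun [set: R] W -> measurable_fun [set: R] L -> measurable_fun [set: R] B ->
    (forall n, measurable_fun [set: R] (phi n)) ->
    (forall x : R, 0 < x -> 0 <= W x) -> (forall n (x : R), 0 < x -> 0 <= phi n x) ->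
    (forall N (x : R), 0 < x -> `|\sum_(0 <= n < N) u n * phi n x| <= B x) ->
    (forall x : R, 0 < x -> \sum_(0 <= n < N) u n * phi n x @[N --> \oo] --> L x) ->
    (posI (fun x => W x * B x)%R < +oo)%E ->
    (forall n, posI (fun x => W x * phi n x) = (m n)%:E) ->
    posI (fun x => W x * L x) = l%:E ->
  \sum_(0 <= n < N) u n * m n @[N --> \oo] --> l.
Proof.
move=> mW mL mB mphi W0 phi0 leB cvgL WB Wm WL.
pose f_ N x := (W x * \sum_(0 <= n < N) u n * phi n x)%:E.
have iphi n : (@lebesgue_measure R).-integrable (@posR R) (fun x => (W x * phi n x)%:E).
  apply: integrable_posI; first exact: measurable_funM.
    by move=> x x0; rewrite mulr_ge0 ?W0 ?phi0.
  by rewrite Wm ltry.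
have B0 x : 0 < x -> 0 <= B x.
  by move=> x0; apply: le_trans (leB 0%N x x0).
have mf_ N : measurable_fun (@posR R) (f_ N).
  apply/measurable_EFinP; apply: measurable_funTS; apply: measurable_funM => //.
  by apply: measurable_sum => n; apply: measurable_funM.
have mf : measurable_fun (@posR R) (fun x => (W x * L x)%:E).
  by apply/measurable_EFinP; apply: measurable_funTS; exact: measurable_funM.
have f_f : {ae @lebesgue_measure R, forall x, @posR R x -> f_ ^~ x @ \oo --> (W x * L x)%:E}.
  apply: aeW => x; rewrite posRE => x0.
  apply: cvg_EFin; first by apply: nearW.
  by apply: cvgM; [exact: cvg_cst|exact: cvgL].
have ig : (@lebesgue_measure R).-integrable (@posR R) (fun x => (W x * B x)%:E).
  apply: integrable_posI => //; first exact: measurable_funM.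
  by move=> x x0; rewrite mulr_ge0 ?W0 ?B0.
have f_g : {ae @lebesgue_measure R, forall x N, @posR R x -> (`|f_ N x| <= (W x * B x)%:E)%E}.
  apply: aeW => x N; rewrite posRE => x0.
  by rewrite /f_ /= lee_fin normrM ger0_norm ?W0// ler_wpM2l ?W0// leB.
have [_ _] := @dominated_convergence _ _ R (@lebesgue_measure R) (@posR R)
  (measurable_posR R) f_ _ _ mf_ mf f_f ig f_g.
have -> : (fun N => \int[@lebesgue_measure R]_(x in @posR R) f_ N x)%E =
    (fun N => (\sum_(0 <= n < N) u n * m n)%:E).
  apply/funext => N.
  transitivity (\int[@lebesgue_measure R]_(x in @posR R)
      (\sum_(0 <= n < N) (u n)%:E * (W x * phi n x)%:E))%E.
    apply: eq_integral => x _; rewrite /f_ mulr_sumr -sumEFin.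
    by apply: eq_bigr => n _; rewrite mulrCA.
  rewrite integral_sum//; last 2 first.
  - exact: measurable_posR.
  - by move=> n; apply: integrableZl; [exact: measurable_posR|exact: iphi].
  rewrite -sumEFin; apply: eq_bigr => n _.
  by rewrite integralZl//; [rewrite -/(posI _) Wm | exact: measurable_posR].
rewrite -/(posI _) WL => /fine_cvgP[_].
by [].
Qed.

(** Supplies the majorant [B] of [posI_series] from a convergent series of absolute bounds. *)
Lemma ler_norm_sum_cvg (u v : nat -> R) l : (forall n, `|u n| <= v n) ->
  \sum_(0 <= n < N) v n @[N --> \oo] --> l ->
  forall N, `|\sum_(0 <= n < N) u n| <= l.
Proof.
move=> uv vl N; apply: (@le_trans _ _ (\sum_(0 <= n < N) v n)).
  by apply: le_trans (ler_norm_sum _ _ _) _; apply: ler_sum.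
rewrite -(cvg_lim _ vl)//.
apply: (@nondecreasing_cvgn_le _ (fun N => \sum_(0 <= n < N) v n)).
  apply/nondecreasing_seqP => n; rewrite big_nat_recr//= lerDl.
  exact: le_trans (uv n).
by apply/cvg_ex; exists l.
Qed.

Lemma cvg_expR_series x : \sum_(0 <= n < N) x ^+ n / n`!%:R @[N --> \oo] --> expR x.
Proof. exact: is_cvg_series_exp_coeff. Qed.

Lemma pochE a n : 0 < a -> Gammaf (a + n%:R) = poch a n * Gammaf a.
Proof.
move=> a0; elim: n => [|n IHn]; first by rewrite addr0 /poch big_ord0 mul1r.
rewrite -natr1 addrA GammafS; last by rewrite ltr_wpDr.
rewrite IHn /poch big_ord_recr/=.
by rewrite mulrCA mulrA.
Qed.

Lemma poch_ge0 a n : 0 <= a -> 0 <= poch a n.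
Proof. by move=> a0; apply: prodr_ge0 => i _; rewrite addr_ge0. Qed.

Lemma poch_gt0 a n : 0 < a -> 0 < poch a n.
Proof. by move=> a0; apply: prodr_gt0 => i _; rewrite ltr_wpDr. Qed.

(** (1 - y)^(-a) is the mean of e^(y r) under the gamma density [W] of shape a and rate 1. Expanding
    the exponential, the n-th moment Gamma(a+n)/Gamma(a) is [poch a n]. *)
Lemma cvg_binomial_series a y : 0 < a -> `|y| < 1 ->
  \sum_(0 <= n < N) poch a n / n`!%:R * y ^+ n @[N --> \oo] --> (1 - y) `^ (- a).
Proof.
move=> a0 y1; have G0 := Gammaf_gt0 _ _ a0.
pose W r := (Gammaf a)^-1 * (r `^ (a - 1) * expR (- (1 * r))).
have W0 r : 0 <= W r by rewrite !mulr_ge0 ?invr_ge0 ?powR_ge0 ?expR_ge0// ltW.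
have exp_int z : `|z| < 1 -> posI (fun r => W r * expR (z * r)) = ((1 - z) `^ (- a))%:E.
  move=> z1; have z0 : 0 < 1 - z by rewrite subr_gt0 (le_lt_trans (ler_norm z)).
  rewrite (eq_posI _ _ (fun r => (Gammaf a)^-1 * (r `^ (a - 1) * expR (- ((1 - z) * r))))); last first.
    move=> r r0; rewrite /W -!mulrA -expRD; congr (_ * (_ * expR _)); ring.
  rewrite posIZl ?invr_ge0 ?ltW//; last 2 first.
  - by measurability.
  - by move=> r r0; rewrite mulr_ge0 ?powR_ge0 ?expR_ge0.
  by rewrite posI_gamma// -EFinM mulrCA mulVf ?mulr1// gt_eqF.
under eq_fun do under eq_bigr do rewrite mulrAC -mulrA mulrC.
(* The majorant e^(|y| r) is integrable against [W] because |y| < 1. *)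
apply: (@posI_series W (fun r => expR (y * r)) (fun r => expR (`|y| * r))
  (fun n r => r ^+ n)).
- by rewrite /W; measurability.
- by measurability.
- by measurability.
- by move=> n; measurability.
- by [].
- by move=> n x x0; rewrite exprn_ge0// ltW.
- move=> N x x0; apply: (@ler_norm_sum_cvg _ (fun n => (`|y| * x) ^+ n / n`!%:R)).
    move=> n; rewrite !normrM normrV ?unitfE ?pnatr_eq0 -?lt0n ?fact_gt0//.
    by rewrite !normrX exprMn (gtr0_norm x0) normr_nat mulrAC.
  exact: cvg_expR_series.
- move=> x x0; have := cvg_expR_series (y * x).
  by under eq_fun do under eq_bigr do rewrite exprMn mulrAC.
- by rewrite exp_int ?normr_id// ltry.
- move=> n; have an0 : 0 < a + n%:R by rewrite ltr_wpDr.
  rewrite (eq_posI _ _ (fun r => (Gammaf a)^-1 * (r `^ (a + n%:R - 1) * expR (- (1 * r))))); last first.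
    move=> r r0; rewrite /W -powR_mulrn ?ltW// addrAC [in RHS]powRD; first by ring.
    by rewrite (gt_eqF r0) implybT.
  rewrite posIZl ?invr_ge0 ?ltW//; last 2 first.
  - by measurability.
  - by move=> r r0; rewrite mulr_ge0 ?powR_ge0 ?expR_ge0.
  by rewrite posI_gamma// powR1 mul1r -EFinM pochE// mulrC mulfK// gt_eqF.
- exact: exp_int.
Qed.

(** In the binomial series of (1 - z t)^(-a), integration replaces t^n by its moment, which yields
    the coefficients of 2F1. Since |z t| <= |z|, all partial sums are bounded by the constant (1 -
    |z|)^(-a). *)
Lemma hyp2F1_seriesE a c d z h t : 0 < a -> `|z| < 1 ->
    measurable_fun [set: R] h -> measurable_fun [set: R] t ->
    (forall x : R, 0 < x -> 0 <= h x) -> (forall x : R, 0 < x -> 0 <= t x <= 1) ->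
    (forall n, posI (fun x => h x * t x ^+ n) = (poch c n / poch d n)%:E) ->
  posI (fun x => h x * (1 - z * t x) `^ (- a)) = (hyp2F1_series a c d z)%:E.
Proof.
move=> a0 z1 mh mt h0 t01 moments.
have tz x : 0 < x -> `|z * t x| <= `|z|.
  move=> x0; have /andP[t0 t1] := t01 _ x0.
  by rewrite normrM (ger0_norm t0) ler_piMr.
have tz1 x : 0 < x -> `|z * t x| < 1 by move=> x0; exact: le_lt_trans (tz _ x0) z1.
have z10 : 0 < 1 - `|z| by rewrite subr_gt0.
have bound x : 0 < x -> (1 - z * t x) `^ (- a) <= (1 - `|z|) `^ (- a).
  move=> x0; have := tz _ x0; rewrite ler_norml => /andP[_ h1].
  have h2 : 1 - `|z| <= 1 - z * t x by rewrite lerD2l lerN2.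
  have h3 : 0 < 1 - z * t x := lt_le_trans z10 h2.
  rewrite !powRN lef_pV2 ?posrE ?powR_gt0//.
  by apply: ge0_ler_powR; rewrite ?nnegrE ?(ltW a0)// ltW.
(* The zeroth moment says that [h] has total mass 1. *)
have B1 : posI (fun x => h x * (1 - `|z|) `^ (- a)) = ((1 - `|z|) `^ (- a))%:E.
  under eq_posI do rewrite mulrC.
  have := moments 0%N; rewrite /poch !big_ord0 divr1.
  rewrite (eq_posI _ _ h); last by move=> x _; rewrite expr0 mulr1.
  by rewrite posIZl// => [->|]; [rewrite mule1|rewrite powR_ge0].
have fin : posI (fun x => h x * (1 - z * t x) `^ (- a)) \is a fin_num.
  rewrite ge0_fin_numE; last by apply: posI_ge0 => x x0; rewrite mulr_ge0 ?h0 ?powR_ge0.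
  apply: (@le_lt_trans _ _ (posI (fun x => h x * (1 - `|z|) `^ (- a))%R)); last by rewrite B1 ltry.
  apply: le_posI; [by measurability|by measurability|move=> x x0].
  by rewrite mulr_ge0 ?h0 ?powR_ge0//= ler_wpM2l ?h0// bound.
rewrite -(fineK fin); congr EFin; apply/esym/cvg_lim => //.
have coefE n : poch a n * poch c n / (poch d n * n`!%:R) * z ^+ n =
    poch a n / n`!%:R * z ^+ n * (poch c n / poch d n) by rewrite invfM; ring.
under eq_fun do under eq_bigr do rewrite coefE.
apply: (@posI_series h (fun x => (1 - z * t x) `^ (- a)) (fun=> (1 - `|z|) `^ (- a))
  (fun n x => t x ^+ n)) => //.
- by measurability.
- by move=> n; measurability.
- by move=> n x x0; have /andP[t0 t1] := t01 _ x0; rewrite exprn_ge0.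
- move=> N x x0; apply: (@ler_norm_sum_cvg _ (fun n => poch a n / n`!%:R * `|z| ^+ n)).
    move=> n; rewrite !normrM (ger0_norm (poch_ge0 _ _ (ltW a0))) !normrX.
    rewrite normrV ?unitfE ?pnatr_eq0 -?lt0n ?fact_gt0// normr_nat.
    have /andP[t0 t1] := t01 _ x0.
    apply: ler_piMr; last by rewrite (ger0_norm t0) exprn_ile1.
    apply: mulr_ge0; last by rewrite exprn_ge0.
    by rewrite mulr_ge0 ?invr_ge0 ?ler0n// poch_ge0// ltW.
  by apply: cvg_binomial_series; rewrite ?normr_id.
- move=> x x0; have := cvg_binomial_series _ _ a0 (tz1 _ x0).
  by under eq_fun do under eq_bigr do rewrite exprMn mulrA.
- by rewrite B1 ltry.
- by rewrite fineK.
Qed.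

End series.

(** * Representation of the Beta law by a weight and a function *)

Section mixing.
Variable R : realType.
Implicit Types (f g h t : R -> R) (a b c d k p q r s w x y z : R).

(** A weight with a function, rather than a density in t, leaves room for the unit mass at 1. The
    first identity gives the power moments, the second serves the Pfaff branch, and the third is the
    closed form of 2F1(d,c;d;-x). *)
Definition beta_mixing c d h t :=
  [/\ [/\ measurable_fun [set: R] h, measurable_fun [set: R] t,
          forall w, 0 <= h w & forall w, 0 < w -> 0 < t w <= 1],
      forall s, s < c -> posI (fun w => h w * t w `^ (- s)) =
        (Gammaf (c - s) * Gammaf d / (Gammaf c * Gammaf (d - s)))%:E,
      forall n, posI (fun w => h w * (1 - t w) ^+ n) = (poch (d - c) n / poch d n)%:E &
      forall x, 0 < x -> posI (fun w => h w * (1 + x * t w) `^ (- d)) = ((1 + x) `^ (- c))%:E].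

(** With t constantly 1, any weight of mass 1 represents the unit mass; e^(-w) is one whose integral
    is at hand. *)
Lemma beta_mixing_diag c : 0 < c -> beta_mixing c c (fun w => expR (- w)) (fun=> 1).
Proof.
move=> c0; split.
- split; [by measurability|by measurability|by move=> w; exact: expR_ge0|].
  by move=> w _; rewrite ltr01 lexx.
- move=> s sc; rewrite powR1.
  rewrite (eq_posI _ _ (fun w => expR (- w))); last by move=> w _; rewrite mulr1.
  have G1 := Gammaf_gt0 _ _ c0; have sc0 : 0 < c - s by rewrite subr_gt0.
  have G2 := Gammaf_gt0 _ _ sc0.
  by rewrite posI_expRN [Gammaf c * _]mulrC divff// mulf_neq0// ?(gt_eqF G1) ?(gt_eqF G2).
- move=> [|n].
    rewrite /poch !big_ord0 divr1 -(posI_expRN R).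
    by apply: eq_posI => w _; rewrite expr0 mulr1.
  (* The first factor of this product is c - c. *)
  have -> : poch (c - c) n.+1 = 0 by rewrite /poch big_ord_recl/= subrr addr0 mul0r.
  rewrite mul0r.
  rewrite (eq_posI _ _ (fun=> 0)); first by rewrite /posI integral0.
  by move=> w _; rewrite subrr expr0n mulr0.
- move=> x x0; rewrite mulr1.
  rewrite (eq_posI _ _ (fun w => (1 + x) `^ (- c) * expR (- w))); last by move=> w _; rewrite mulrC.
  by rewrite posIZl ?powR_ge0 ?posI_expRN ?mule1//; measurability.
Qed.

(* [w] has the beta prime law, so that [w / (1 + w)] has the law Beta(c, d - c). *)
Lemma beta_mixing_ratio c d : 0 < c -> c < d ->
  beta_mixing c d
    (fun w => Gammaf d / (Gammaf c * Gammaf (d - c)) * (w `^ (c - 1) * (1 + w) `^ (- d)))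
    (fun w => w / (1 + w)).
Proof.
move=> c0 cd; have d0 := lt_trans c0 cd; have dc0 : 0 < d - c by rewrite subr_gt0.
have Gc := Gammaf_gt0 _ _ c0; have Gd := Gammaf_gt0 _ _ d0; have Gdc := Gammaf_gt0 _ _ dc0.
set N := Gammaf d / (Gammaf c * Gammaf (d - c)).
have N0 : 0 <= N by rewrite divr_ge0 ?mulr_ge0 ?(ltW Gc) ?(ltW Gd) ?(ltW Gdc).
have NE : N = Gammaf d / (Gammaf c * Gammaf (d - c)) by [].
clearbody N.
have betaN a b : 0 < a -> 0 < b ->
    posI (fun w => N * (w `^ (a - 1) * (1 + w) `^ (- (a + b)))) =
    (N * (Gammaf a * Gammaf b / Gammaf (a + b)))%:E.
  move=> a0 b0; rewrite posIZl ?posI_beta//; first by measurability.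
  by move=> w w0; rewrite mulr_ge0 ?powR_ge0.
split.
- split; [by measurability|by measurability| |].
    by move=> w; rewrite !mulr_ge0 ?powR_ge0.
  move=> w w0; have w1 : 0 < 1 + w by rewrite addr_gt0.
  by rewrite divr_gt0//= ler_pdivrMr// mul1r lerDr.
- move=> s sc; have sc0 : 0 < c - s by rewrite subr_gt0.
  have ds0 : 0 < d - s by rewrite subr_gt0 (lt_trans sc).
  rewrite (eq_posI _ _ (fun w => N * (w `^ ((c - s) - 1) * (1 + w) `^ (- ((c - s) + (d - c)))))).
    rewrite betaN//; congr EFin.
    have -> : c - s + (d - c) = d - s by ring.
    rewrite NE; field.
    by rewrite (gt_eqF Gc) (gt_eqF Gdc) (gt_eqF (Gammaf_gt0 _ _ ds0)).
  move=> w w0; have w1 : 0 < 1 + w by rewrite addr_gt0.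
  rewrite -mulrA; congr (_ * _).
  rewrite !powR_expR ?divr_gt0// ln_div ?posrE// -!expRD; congr expR; ring.
- move=> n; have n0 : 0 < d - c + n%:R by rewrite ltr_wpDr.
  (* Since 1 - t = 1/(1 + w), the n extra factors raise the second Beta parameter from d - c to d -
     c + n. *)
  rewrite (eq_posI _ _ (fun w => N * (w `^ (c - 1) * (1 + w) `^ (- (c + (d - c + n%:R)))))).
    rewrite betaN//; congr EFin.
    have -> : c + (d - c + n%:R) = d + n%:R by ring.
    rewrite (pochE _ _ _ dc0) (pochE _ _ _ d0) NE; field.
    by rewrite (gt_eqF Gc) (gt_eqF Gd) (gt_eqF Gdc) (gt_eqF (poch_gt0 _ _ n d0)).
  move=> w w0; have w1 : 0 < 1 + w by rewrite addr_gt0.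
  rewrite -mulrA; congr (_ * _).
  have -> : 1 - w / (1 + w) = (1 + w)^-1 by field; rewrite gt_eqF.
  rewrite exprVn exprV_expR// !powR_expR// -!expRD; congr expR; ring.
- move=> x x0; have x1 : 0 < 1 + x by rewrite addr_gt0.
  (* As 1 + x t = (1 + (1 + x) w)/(1 + w), rescaling w by 1 + x recovers the normalizing Beta
     integral, with (1 + x)^(-c) in front. *)
  rewrite (eq_posI _ _ (fun w => (1 + x) `^ (- c) *
    (N * (((1 + x) * w) `^ (c - 1) * (1 + (1 + x) * w) `^ (- d) * (1 + x))))).
    rewrite posIZl ?powR_ge0//; last 2 first.
    + by measurability.
    + by move=> w w0; rewrite !mulr_ge0 ?powR_ge0 ?(ltW x1).
    rewrite posIZl//; last 2 first.
    + by measurability.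
    + by move=> w w0; rewrite !mulr_ge0 ?powR_ge0 ?(ltW x1).
    rewrite -(posI_scale _ _ (fun w => w `^ (c - 1) * (1 + w) `^ (- d)))//; last 2 first.
    + move=> w w0; apply: cvgM; first exact: continuous_powR.
      apply: (@continuous_comp _ _ _ (fun w : R => 1 + w) (fun u : R => u `^ (- d))).
        by apply: cvgD; [exact: cvg_cst|exact: cvg_id].
      by apply: continuous_powR; rewrite addr_gt0.
    + by move=> w w0; rewrite mulr_ge0 ?powR_ge0.
    have -> : (fun w => w `^ (c - 1) * (1 + w) `^ (- d)) =
        (fun w => w `^ (c - 1) * (1 + w) `^ (- (c + (d - c)))).
      by have -> : c + (d - c) = d by ring.
    rewrite posI_beta// -!EFinM; congr EFin.
    have -> : c + (d - c) = d by ring.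
    by rewrite NE; field; rewrite (gt_eqF Gc) (gt_eqF Gd) (gt_eqF Gdc).
  move=> w w0; have w1 : 0 < 1 + w by rewrite addr_gt0.
  have xw0 : 0 < (1 + x) * w by rewrite mulr_gt0.
  have -> : 1 + x * (w / (1 + w)) = (1 + (1 + x) * w) / (1 + w) by field; rewrite gt_eqF.
  have xw1 : 0 < 1 + (1 + x) * w by rewrite addr_gt0.
  rewrite [RHS]mulrCA -[LHS]mulrA; congr (_ * _).
  rewrite !powR_expR ?divr_gt0// ln_div ?posrE// lnM ?posrE//.
  rewrite -[in X in _ = _ * (_ * X)](@lnK _ (1 + x)) ?posrE// -!expRD; congr expR; ring.
Qed.

Lemma beta_mixing_exists c d : 0 < c -> c <= d -> exists h t, beta_mixing c d h t.
Proof.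
move=> c0; rewrite le_eqVlt => /predU1P[<-|cd]; do 2 eexists.
  exact: beta_mixing_diag.
exact: beta_mixing_ratio.
Qed.

End mixing.

(** * Integral representations of 2F1 and integrals of Kummer's function *)

Section mixed.
Variable R : realType.
Implicit Types (a k q s x : R).
Variables (c d : R) (h t : R -> R).
Hypotheses (c0 : 0 < c) (cd : c <= d) (ht : beta_mixing _ c d h t).

Let d0 : 0 < d. Proof. exact: lt_le_trans cd. Qed.
Let mh : measurable_fun [set: R] h. Proof. by case: ht => -[]. Qed.
Let mt : measurable_fun [set: R] t. Proof. by case: ht => -[]. Qed.
Let h0 w : 0 <= h w. Proof. by case: ht => -[]. Qed.
Let t01 w : 0 < w -> 0 < t w <= 1. Proof. by case: ht => -[_ _ _ H] _ _ _; exact: H. Qed.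

Lemma posI_mixing : posI h = 1%E.
Proof.
case: ht => _ _ /(_ 0%N) + _; rewrite /poch !big_ord0 divr1 => <-.
by apply: eq_posI => w _; rewrite expr0 mulr1.
Qed.

Lemma mixing_moment n : posI (fun w => h w * t w ^+ n) = (poch c n / poch d n)%:E.
Proof.
(* The n-th moment of t is the case s = -n of the first identity of [beta_mixing]. *)
have nc : - n%:R < c by rewrite (le_lt_trans _ c0)// oppr_le0.
case: ht => _ /(_ _ nc) + _ _; rewrite opprK => E.
rewrite (eq_posI _ _ (fun w => h w * t w `^ n%:R)).
  rewrite E (pochE _ _ _ c0) (pochE _ _ _ d0); congr EFin; field.
  by rewrite (gt_eqF (Gammaf_gt0 _ _ c0)) (gt_eqF (Gammaf_gt0 _ _ d0)) (gt_eqF (poch_gt0 _ _ n d0)).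
by move=> w /t01 /andP[/ltW tw _]; rewrite powR_mulrn.
Qed.

(** For x < 1 this is the series representation at -x. For x >= 1 the Pfaff argument is z = x/(1 +
    x), and 1 - z (1 - t) = (1 + x t)/(1 + x) turns the other branch into the same integral. *)
Lemma hyp2F1_mixing a x : 0 < a -> 0 < x ->
  posI (fun w => h w * (1 + x * t w) `^ (- a)) = (hyp2F1 a c d (- x))%:E.
Proof.
move=> a0 x0; rewrite /hyp2F1; case: ifPn => [x1|].
  have tle w : 0 < w -> 0 <= t w <= 1 by move=> /t01 /andP[/ltW -> ->].
  rewrite -(hyp2F1_seriesE _ a c d (- x) h t a0 x1 mh mt (fun w _ => h0 w) tle mixing_moment).
  by apply: eq_posI => w _; rewrite mulNr opprK.
rewrite -leNgt normrN gtr0_norm// => x1; rewrite oppr_lt0 x0 opprK.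
set z := - x / (- x - 1).
have zE : z = x / (1 + x) by rewrite /z -opprD invrN mulrNN [x + 1]addrC.
have x10 : 0 < 1 + x by rewrite addr_gt0.
have zP : 0 < z < 1 by rewrite zE divr_gt0//= ltr_pdivrMr// mul1r ltrDr.
have /andP[z0 z1] := zP.
rewrite EFinM -(hyp2F1_seriesE _ a (d - c) d z h (fun w => 1 - t w))//; first last.
- by case: ht.
- by move=> w /t01 /andP[tw0 tw1]; rewrite subr_ge0 tw1 lerBlDr lerDl ltW.
- by measurability.
- by rewrite gtr0_norm.
rewrite -posIZl ?powR_ge0//; last 2 first.
- by measurability.
- by move=> w w0; rewrite mulr_ge0 ?powR_ge0.
apply: eq_posI => w /t01 /andP[tw0 tw1]; rewrite mulrCA; congr (_ * _).
have -> : 1 - z * (1 - t w) = (1 + x * t w) / (1 + x) by rewrite zE; field; rewrite gt_eqF.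
rewrite -powRM ?ltW// ?divr_gt0// ?addr_gt0 ?mulr_gt0//.
by congr (_ `^ _); field; rewrite gt_eqF.
Qed.

(** As t <= 1 and [h] has mass 1, the integral representation is at least (1 + x)^(-a). *)
Lemma hyp2F1_gt0 a x : 0 < a -> 0 < x -> 0 < hyp2F1 a c d (- x).
Proof.
move=> a0 x0; have x10 : 0 < 1 + x by rewrite addr_gt0.
rewrite -lte_fin -hyp2F1_mixing//.
apply: (@lt_le_trans _ _ (posI (fun w => (1 + x) `^ (- a) * h w)%R)).
  by rewrite posIZl ?powR_ge0// posI_mixing mule1 lte_fin powR_gt0.
apply: le_posI; [by measurability|by measurability|].
move=> w /t01 /andP[tw0 tw1]; rewrite mulr_ge0 ?powR_ge0//= mulrC ler_wpM2l//.
rewrite !powRN lef_pV2 ?posrE ?powR_gt0 ?addr_gt0 ?mulr_gt0//.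
apply: ge0_ler_powR; rewrite ?nnegrE ?(ltW a0) ?(ltW x10)//.
  by rewrite ltW// addr_gt0// mulr_gt0.
by rewrite lerD2l ler_piMr// ltW.
Qed.

(* The Laplace transform of the mixing law, i.e. Kummer's 1F1(c; d; -x). *)
Definition kummer x := fine (posI (fun w => h w * expR (- (x * t w)))).

Lemma kummerE x : 0 < x -> posI (fun w => h w * expR (- (x * t w))) = (kummer x)%:E.
Proof.
move=> x0; rewrite fineK// ge0_fin_numE; last first.
  by apply: posI_ge0 => w _; rewrite mulr_ge0 ?expR_ge0.
apply: (@le_lt_trans _ _ (posI h)); last by rewrite posI_mixing ltry.
apply: le_posI => //; first by measurability.
move=> w /t01 /andP[tw0 tw1]; rewrite mulr_ge0 ?expR_ge0//= ler_piMr//.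
by rewrite expR_le1 oppr_le0 mulr_ge0// ltW.
Qed.

Lemma kummer_ge0 x : 0 <= kummer x.
Proof. by rewrite fine_ge0// posI_ge0// => w _; rewrite mulr_ge0 ?expR_ge0. Qed.

Lemma measurable_kummer : measurable_fun [set: R] kummer.
Proof.
apply: (@measurableT_comp _ _ _ _ _ _ (@fine R)).
  exact: fine_measurable.
apply: (measurable_fun_posI _ (fun x w => h w * expR (- (x * t w)))).
  by measurability.
by move=> x w; rewrite mulr_ge0 ?expR_ge0.
Qed.

(** For fixed w the r-integral is a gamma integral of rate 1 + x t, which leaves the representation
    [hyp2F1_mixing]. *)
Lemma posI_kummer_gamma a x : 0 < a -> 0 < x ->
  posI (fun r => r `^ (a - 1) * expR (- r) * kummer (r * x)) =
  (Gammaf a * hyp2F1 a c d (- x))%:E.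
Proof.
move=> a0 x0; rewrite EFinM -hyp2F1_mixing// -posIZl ?Gammaf_ge0//; last 2 first.
- by measurability.
- by move=> w _; rewrite mulr_ge0 ?powR_ge0.
apply: (@exchange_posI _ (fun r w => r `^ (a - 1) * expR (- r) * (h w * expR (- (r * x * t w))))).
- by measurability.
- by move=> r w; rewrite !mulr_ge0 ?powR_ge0 ?expR_ge0.
- move=> r r0; rewrite posIZl ?mulr_ge0 ?powR_ge0 ?expR_ge0//; last 2 first.
  + by measurability.
  + by move=> w _; rewrite mulr_ge0 ?expR_ge0.
  by rewrite kummerE ?mulr_gt0.
- move=> w /t01 /andP[tw0 tw1].
  rewrite (eq_posI _ _ (fun r => h w * (r `^ (a - 1) * expR (- ((1 + x * t w) * r))))).
    rewrite posIZl ?posI_gamma ?addr_gt0 ?mulr_gt0//; last 2 first.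
    + by measurability.
    + by move=> r _; rewrite mulr_ge0 ?powR_ge0 ?expR_ge0.
    by rewrite -EFinM; congr EFin; ring.
  move=> r r0; rewrite mulrCA -!mulrA -expRD; congr (_ * (_ * expR _)); ring.
Qed.

(** For fixed w the s-integral is an inverse-gamma integral with parameter k + x t. Its shape d
    matches the third identity of [beta_mixing], taken at x/k. *)
Lemma posI_kummer_inv_gamma k x : 0 < k -> 0 < x ->
  posI (fun s => s `^ (- d - 1) * expR (- (k / s)) * kummer (x / s)) =
  (Gammaf d * k `^ (- d) * (1 + x / k) `^ (- c))%:E.
Proof.
move=> k0 x0; have xk0 : 0 < x / k by rewrite divr_gt0.
case: ht => _ _ _ /(_ _ xk0) E.
rewrite EFinM -E -posIZl ?mulr_ge0 ?Gammaf_ge0 ?powR_ge0//; last 2 first.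
- by measurability.
- by move=> w _; rewrite mulr_ge0 ?powR_ge0.
apply: (@exchange_posI _ (fun s w => s `^ (- d - 1) * expR (- (k / s)) * (h w * expR (- (x / s * t w))))).
- by measurability.
- by move=> s w; rewrite !mulr_ge0 ?powR_ge0 ?expR_ge0.
- move=> s s0; rewrite posIZl ?mulr_ge0 ?powR_ge0 ?expR_ge0//; last 2 first.
  + by measurability.
  + by move=> w _; rewrite mulr_ge0 ?expR_ge0.
  by rewrite kummerE ?divr_gt0.
- move=> w /t01 /andP[tw0 tw1].
  have kx0 : 0 < k + x * t w by rewrite addr_gt0 ?mulr_gt0.
  rewrite (eq_posI _ _ (fun s => h w * (s `^ (- d - 1) * expR (- ((k + x * t w) / s))))).
    rewrite posIZl ?posI_inv_gamma//; last 2 first.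
    + by measurability.
    + by move=> r _; rewrite mulr_ge0 ?powR_ge0 ?expR_ge0.
    have -> : k + x * t w = k * (1 + x / k * t w) by field; rewrite gt_eqF.
    have p1 : 0 < 1 + x / k * t w by rewrite addr_gt0// mulr_gt0.
    by rewrite powRM ?(ltW k0) ?(ltW p1)// -EFinM; congr EFin; ring.
  move=> s s0; rewrite mulrCA -!mulrA -expRD; congr (_ * (_ * expR _)); ring.
Qed.

(** For fixed w the s-integral is an inverse-gamma integral with parameter x t; the moment of t^(-q)
    that remains is available because q < c. *)
Lemma posI_kummer_power q x : 0 < q -> q < c -> 0 < x ->
  posI (fun s => s `^ (- q - 1) * kummer (x / s)) =
  (x `^ (- q) * Gammaf q * (Gammaf (c - q) * Gammaf d / (Gammaf c * Gammaf (d - q))))%:E.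
Proof.
move=> q0 qc x0; case: ht => _ /(_ _ qc) E _ _.
rewrite EFinM -E -posIZl ?mulr_ge0 ?Gammaf_ge0 ?powR_ge0//; last 2 first.
- by measurability.
- by move=> w _; rewrite mulr_ge0 ?powR_ge0.
apply: (@exchange_posI _ (fun s w => s `^ (- q - 1) * (h w * expR (- (x / s * t w))))).
- by measurability.
- by move=> s w; rewrite !mulr_ge0 ?powR_ge0 ?expR_ge0.
- move=> s s0; rewrite posIZl ?powR_ge0//; last 2 first.
  + by measurability.
  + by move=> w _; rewrite mulr_ge0 ?expR_ge0.
  by rewrite kummerE ?divr_gt0.
- move=> w /t01 /andP[tw0 tw1].
  rewrite (eq_posI _ _ (fun s => h w * (s `^ (- q - 1) * expR (- ((x * t w) / s))))).
    rewrite posIZl ?posI_inv_gamma ?mulr_gt0//; last 2 first.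
    + by measurability.
    + by move=> r _; rewrite mulr_ge0 ?powR_ge0 ?expR_ge0.
    rewrite powRM ?ltW// -EFinM; congr EFin; ring.
  by move=> s s0; rewrite mulrCA [x * t w / s]mulrAC.
Qed.

End mixed.

(** * The density and the mixture equation *)

Lemma continuous_F20_integrand (R : realType) (alpha beta b p q v : R) (y : R) :
  0 < beta -> 0 < b -> 0 < y ->
  {for y, continuous (fun y : R => gamma_pdf alpha (beta / y) v * B2_pdf b p q y)}.
Proof.
move=> beta0 b0 y0.
have cdiv a : {for y, continuous (fun y : R => a / y)}.
  by apply: cvgM; [exact: cvg_cst|apply: cvgV; [rewrite gt_eqF|exact: cvg_id]].
have cpow (g : R -> R) e : 0 < g y -> {for y, continuous g} ->
    {for y, continuous (fun y : R => g y `^ e)}.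
  move=> g0 cg; apply: (@continuous_comp _ _ _ g (fun u : R => u `^ e)) => //.
  exact: continuous_powR.
apply: cvgM.
  apply: cvgM; last first.
    apply: (@continuous_comp _ _ _ (fun y : R => beta / y * v) (fun u : R => expR (- u))).
      by apply: cvgM; [exact: cdiv|exact: cvg_cst].
    exact: continuous_expRN.
  apply: cvgM; last exact: cvg_cst.
  apply: cvgM; last exact: cvg_cst.
  by apply: (cpow (fun y : R => beta / y)); rewrite ?divr_gt0//; exact: cdiv.
apply: cvgM.
  by apply: cvgM; [exact: cvg_cst|exact: continuous_powR].
apply: (cpow (fun y : R => 1 + b / y)); first by rewrite addr_gt0 ?divr_gt0.
by apply: cvgD; [exact: cvg_cst|exact: cdiv].
Qed.

Theorem theorem1 (R : realType) (alpha beta alphat betat b p q : R) :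
  0 < alpha -> 0 < beta -> 0 < alphat -> 0 < betat ->
  0 < b -> 0 < p -> 0 < q -> p <= alphat ->
  let f := f_DSD alpha beta alphat betat b p q in
  [/\ (forall s : R, 0 < s -> 0 < f s),
      measurable_fun (@posR R) f,
      (\int[@lebesgue_measure R]_(s in @posR R) (f s)%:E = 1)%E
    & forall v : R, 0 < v ->
      (\int[@lebesgue_measure R]_(s in @posR R)
          (gamma_pdf alphat (betat / s) v * f s)%:E)%E
      = F20_pdf alpha beta b p q v].
Proof.
move=> alpha0 beta0 alphat0 betat0 b0 p0 q0 pa f.
have A0 : 0 < q + alpha by rewrite addr_gt0.
have c0 : 0 < q + p by rewrite addr_gt0.
have d0 : 0 < q + alphat by rewrite addr_gt0.
(* Here p <= alphat becomes c <= d, the condition under which Beta(c, d - c) is represented. *)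
have cd : q + p <= q + alphat by rewrite lerD2l.
have GA := Gammaf_gt0 _ _ A0; have Gc := Gammaf_gt0 _ _ c0; have Gd := Gammaf_gt0 _ _ d0.
have Ga := Gammaf_gt0 _ _ alpha0; have Gat := Gammaf_gt0 _ _ alphat0.
have Gp := Gammaf_gt0 _ _ p0; have Gq := Gammaf_gt0 _ _ q0.
have BE := BetafE _ _ _ p0 q0; rewrite [p + q]addrC in BE.
have g1E r x : gamma_pdf alpha r x =
  r `^ alpha / Gammaf alpha * x `^ (alpha - 1) * expR (- (r * x)) by [].
have g2E r x : gamma_pdf alphat r x =
  r `^ alphat / Gammaf alphat * x `^ (alphat - 1) * expR (- (r * x)) by [].
have b2E s : B2_pdf b p q s =
  b `^ q / Betaf p q * s `^ (- q - 1) * (1 + b / s) `^ (- p - q) by [].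
pose k := b * betat / beta.
have k0 : 0 < k by rewrite divr_gt0 ?mulr_gt0.
pose K := K_DSD alpha beta alphat betat b p q.
have KE : K = k `^ q / Betaf p q * (Gammaf alphat / Gammaf (q + alphat)) *
  (Gammaf (q + alpha) / Gammaf alpha) by [].
have fE (s : R) : 0 < s ->
    f s = K * s `^ (- q - 1) * hyp2F1 (q + alpha) (q + p) (q + alphat) (- (k / s)).
  move=> s0; congr (K * _ * hyp2F1 _ _ _ (- _)).
  by rewrite /k; field; rewrite (gt_eqF s0) (gt_eqF beta0).
have kE : k = b * betat / beta by [].
clearbody f K k.
have [h [t ht]] := beta_mixing_exists _ _ _ c0 cd.
pose M := kummer R h t.
have M0 x : 0 <= M x by exact: (kummer_ge0 _ _ _ _ _ ht).
have mM : measurable_fun [set: R] M by exact: (measurable_kummer _ _ _ _ _ ht).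
have MG (s : R) : 0 < s ->
    posI (fun r => r `^ (q + alpha - 1) * expR (- r) * M (r * (k / s))) =
    (Gammaf (q + alpha) * hyp2F1 (q + alpha) (q + p) (q + alphat) (- (k / s)))%:E.
  by move=> s0; apply: (posI_kummer_gamma _ _ _ _ _ c0 cd ht); rewrite ?divr_gt0.
have MP x : 0 < x -> posI (fun s => s `^ (- q - 1) * M (x / s)) =
    (x `^ (- q) * Gammaf q *
     (Gammaf p * Gammaf (q + alphat) / (Gammaf (q + p) * Gammaf alphat)))%:E.
  move=> x0; have := posI_kummer_power _ _ _ _ _ ht _ _ q0 _ x0.
  rewrite ltrDl => /(_ p0) ->.
  by rewrite ![q + _]addrC !addrK.
have MI := posI_kummer_inv_gamma _ _ _ _ _ c0 cd ht.
rewrite -/M in MI.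
have hgt0 (s : R) : 0 < s -> 0 < hyp2F1 (q + alpha) (q + p) (q + alphat) (- (k / s)).
  by move=> s0; apply: (hyp2F1_gt0 _ _ _ _ _ c0 cd ht); rewrite ?divr_gt0.
have gI := posI_gamma _ _ _ alpha0 ltr01.
(* Only the identities above matter from here on; generalizing the Gamma and
   Beta values keeps the unifier from comparing them by unfolding integrals. *)
clearbody M; clear ht h t.
move: (hyp2F1 (q + alpha) (q + p) (q + alphat)) hgt0 MG fE => H hgt0 MG fE.
move: (Betaf p q) BE KE b2E => B BE KE b2E.
move: (Gammaf (q + alpha)) (Gammaf (q + p)) (Gammaf (q + alphat)) (Gammaf alpha)
  (Gammaf alphat) (Gammaf p) (Gammaf q) GA Gc Gd Ga Gat Gp Gq BE g1E g2E KE MG MP MI gI.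
move=> gA gc gd ga gat gp gq GA Gc Gd Ga Gat Gp Gq BE g1E g2E KE MG MP MI gI.
have B0 : 0 < B by rewrite BE divr_gt0 ?mulr_gt0.
have K0 : 0 < K by rewrite KE !mulr_gt0 ?invr_gt0 ?powR_gt0.
have neq0 := (gt_eqF GA, gt_eqF Gc, gt_eqF Gd, gt_eqF Ga, gt_eqF Gat, gt_eqF Gp, gt_eqF Gq,
  gt_eqF B0, gt_eqF b0, gt_eqF beta0, gt_eqF betat0).
split.
- by move=> s s0; rewrite fE// !mulr_gt0 ?powR_gt0 ?hgt0.
(* Through [MG], 2F1 becomes a partial integral of a jointly measurable kernel, hence measurable in
   s. *)
- have mF : measurable_fun (@posR R) (fun s => K / gA * s `^ (- q - 1) *
      fine (posI (fun r => r `^ (q + alpha - 1) * expR (- r) * M (r * (k / s))))).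
    apply: measurable_funTS; apply: measurable_funM; first by measurability.
    apply: (@measurableT_comp _ _ _ _ _ _ (@fine R)); first exact: fine_measurable.
    apply: (measurable_fun_posI _ (fun s r => r `^ (q + alpha - 1) * expR (- r) * M (r * (k / s)))).
      by measurability.
    by move=> x r; rewrite !mulr_ge0 ?powR_ge0 ?expR_ge0.
  apply: eq_measurable_fun mF => s; rewrite inE posRE => s0.
  by rewrite MG// fE//=; field; rewrite !neq0.
- pose C := K / gA.
  have C0 : 0 <= C by rewrite divr_ge0 ?ltW.
  have CE : C = K / gA by [].
  clearbody C.
  rewrite -/(posI f).
  (* The constant left by the s-integral; the value of K makes D Gamma(alpha) equal to 1. *)
  pose D := C * (k `^ (- q) * gq *
    (gp * gd / (gc * gat))).
  transitivity (posI (fun r => D * (r `^ (alpha - 1) * expR (- (1 * r))))).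
    (* By [MG] the r-integral is f(s); by [MP] the s-integral is D r^(alpha-1) e^(-r). *)
    apply: (@exchange_posI _ (fun s r => C *
      (s `^ (- q - 1) * (r `^ (q + alpha - 1) * expR (- r) * M (r * (k / s)))))).
    - by measurability.
    - by move=> s r; rewrite !mulr_ge0 ?powR_ge0 ?expR_ge0.
    - move=> s s0; rewrite posIZl//; last 2 first.
      + by measurability.
      + by move=> r _; rewrite !mulr_ge0 ?powR_ge0 ?expR_ge0.
      rewrite posIZl ?powR_ge0//; last 2 first.
      + by measurability.
      + by move=> r _; rewrite !mulr_ge0 ?powR_ge0 ?expR_ge0.
      rewrite MG// -!EFinM fE// CE; congr EFin; field.
      by rewrite !neq0.
    - move=> r r0; have rk0 : 0 < r * k by rewrite mulr_gt0.
      rewrite (eq_posI _ _ (fun s => C * (r `^ (q + alpha - 1) * expR (- r)) *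
        (s `^ (- q - 1) * M ((r * k) / s)))); last first.
        by move=> s s0; rewrite (mulrA r); ring.
      rewrite posIZl ?mulr_ge0 ?powR_ge0 ?expR_ge0//; last 2 first.
      + by measurability.
      + by move=> s _; rewrite !mulr_ge0 ?powR_ge0.
      rewrite MP// -EFinM; congr EFin; rewrite /D mul1r.
      have -> : r `^ (alpha - 1) = r `^ (q + alpha - 1) * r `^ (- q).
        by rewrite !powR_expR// -expRD; congr expR; ring.
      rewrite powRM ?(ltW r0) ?(ltW k0)//; ring.
  rewrite posIZl; last 3 first.
  + by rewrite /D !mulr_ge0 ?invr_ge0 ?powR_ge0 ?mulr_ge0// ?ltW.
  + by measurability.
  + by move=> r _; rewrite !mulr_ge0 ?powR_ge0 ?expR_ge0.
  rewrite gI powR1 mul1r -EFinM; congr EFin.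
  rewrite /D CE KE BE powRN; field.
  by rewrite !neq0 gt_eqF ?powR_gt0.
- move=> v v0.
  pose C := K / gA * (betat `^ alphat / gat * v `^ (alphat - 1)).
  have C0 : 0 <= C by rewrite !mulr_ge0 ?invr_ge0 ?powR_ge0 ?ltW.
  have CE : C = K / gA * (betat `^ alphat / gat * v `^ (alphat - 1)).
    by [].
  clearbody C.
  have bv0 : 0 < beta * v by rewrite mulr_gt0.
  have btv0 : 0 < betat * v by rewrite mulr_gt0.
  rewrite /F20_pdf -/(posI _) -/(posI _).
  (* The substitution y = beta v / r makes the gamma factor e^(-r), which is the weight in [MG]. *)
  rewrite [RHS](posI_inv _ _ _ bv0); last 2 first.
  + by move=> y y0; exact: continuous_F20_integrand.
  + move=> y y0; rewrite g1E b2E !mulr_ge0 ?powR_ge0 ?expR_ge0 ?invr_ge0//.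
      exact: ltW.
    exact: ltW.
  (* By [MG] the r-integral is the mixture integrand at s. By [MI], of shape q + alphat, the
     s-integral is the substituted [F20_pdf] integrand at r. *)
  apply: (@exchange_posI _ (fun s r => C *
      (s `^ (- (q + alphat) - 1) * expR (- (betat * v / s)) *
      (r `^ (q + alpha - 1) * expR (- r) * M (r * (k / s)))))).
  + by measurability.
  + by move=> s r; rewrite !mulr_ge0 ?powR_ge0 ?expR_ge0.
  + move=> s s0; rewrite posIZl//; last 2 first.
    * by measurability.
    * by move=> r _; rewrite !mulr_ge0 ?powR_ge0 ?expR_ge0.
    rewrite posIZl ?mulr_ge0 ?powR_ge0 ?expR_ge0//; last 2 first.
    * by measurability.
    * by move=> r _; rewrite !mulr_ge0 ?powR_ge0 ?expR_ge0.
    rewrite MG// -!EFinM fE// CE g2E; congr EFin.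
    rewrite (mulrAC betat).
    have -> : s `^ (- (q + alphat) - 1) = s `^ (- q - 1) * s `^ (- alphat).
      by rewrite !powR_expR// -expRD; congr expR; ring.
    rewrite powRM ?invr_ge0 ?(ltW s0) ?(ltW betat0)//.
    have -> : s^-1 `^ alphat = s `^ (- alphat).
      by rewrite !powR_expR ?invr_gt0// lnV ?posrE//; congr expR; ring.
    by field; rewrite !neq0 ?(gt_eqF s0) ?(gt_eqF r0) ?(gt_eqF v0).
  + move=> r r0; have rk0 : 0 < r * k by rewrite mulr_gt0.
    rewrite (eq_posI _ _ (fun s => C * (r `^ (q + alpha - 1) * expR (- r)) *
      (s `^ (- (q + alphat) - 1) * expR (- (betat * v / s)) * M ((r * k) / s)))); last first.
      by move=> s s0; rewrite (mulrA r); ring.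
    rewrite posIZl ?mulr_ge0 ?powR_ge0 ?expR_ge0//; last 2 first.
    * by measurability.
    * by move=> s _; rewrite !mulr_ge0 ?powR_ge0 ?expR_ge0.
    rewrite MI// -EFinM; congr EFin.
    (* The value of k makes betat cancel, and the factor of [B2_pdf] at y = beta v / r appears. *)
    have -> : 1 + r * k / (betat * v) = 1 + b / (beta * v / r).
      by rewrite kE; field; rewrite !neq0 ?(gt_eqF s0) ?(gt_eqF r0) ?(gt_eqF v0).
    rewrite g1E b2E (_ : - p - q = - (q + p)); last by ring.
    have -> : beta / (beta * v / r) = r / v.
      by field; rewrite !neq0 ?(gt_eqF r0) ?(gt_eqF v0).
    rewrite (divfK (lt0r_neq0 v0)).
    set Y := (1 + _) `^ _.
    (* All powers outside the common factors [Y] and e^(-r) are gathered here; in logarithms the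
       equality is a polynomial identity. *)
    have key : k `^ q * betat `^ alphat * v `^ (alphat - 1) *
        (betat * v) `^ (- (q + alphat)) * r `^ (q + alpha - 1) =
        (r / v) `^ alpha * v `^ (alpha - 1) * b `^ q * (beta * v / r) `^ (- q - 1) *
        (beta * v * r ^- 2).
      rewrite -[in X in _ = _ * (X * _)](@lnK _ (beta * v)) ?posrE// exprV_expR//.
      rewrite !powR_expR ?divr_gt0// kE !ln_div ?posrE ?mulr_gt0// !lnM ?posrE//.
      by rewrite -!expRD; congr expR; ring.
    transitivity (Y * expR (- r) / (B * ga) *
      (k `^ q * betat `^ alphat * v `^ (alphat - 1) *
        (betat * v) `^ (- (q + alphat)) * r `^ (q + alpha - 1))).
      by rewrite CE KE; field; rewrite !neq0 ?(gt_eqF s0) ?(gt_eqF r0) ?(gt_eqF v0).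
    by rewrite key; field; rewrite !neq0 ?(gt_eqF s0) ?(gt_eqF r0) ?(gt_eqF v0).
Qed.
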